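(* There is an absolute constant $A>0$ such that the following holds. Let $G$ be an $n$-vertex $d$-degenerate graph with diameter $D$ and maximum degree $\Delta$, and let $s\in V(G)$ be an arbitrary vertex. Then, with probability at least $1-A/n$, $$h(\mathcal{T}(G,s))\le 8e\sqrt{d\Delta}\,(2D+4\ln n).$$
   Context: All graphs are finite, simple, undirected and connected. A graph is $d$-degenerate if each of its subgraphs has a vertex of degree at most $d$. For a graph $G$ on $n$ vertices and $s\in V(G)$, build random subtrees $T_1,\dots,T_n$ of $G$: $T_1$ is the single vertex $s$, and for $1<i\le n$, $T_i$ is obtained from $T_{i-1}$ by choosing, uniformly at random, an edge of $G$ with exactly one endpoint in $T_{i-1}$ and adding it (with its other endpoint) to $T_{i-1}$. The random spanning tree $T_n$, rooted at $s$, is denoted $\mathcal{T}(G,s)$. The height $h(T)$ of a rooted tree $T$ is the maximum number of edges on a root-to-leaf path. $\ln$ is the natural logarithm. *)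

(* Defs.v *)
From mathcomp Require Import all_boot all_order all_algebra.
From mathcomp Require Import reals.

Set Implicit Arguments.
Unset Strict Implicit.
Unset Printing Implicit Defensive.

Import Order.TTheory GRing.Theory Num.Theory.

(* A simple graph on the finite vertex type T is a symmetric irreflexive
   relation g : rel T. *)
Definition simple_graph (T : finType) (g : rel T) : Prop :=
  symmetric g /\ irreflexive g.

Definition connected_graph (T : finType) (g : rel T) : Prop :=
  forall x y : T, connect g x y.

Definition degree (T : finType) (g : rel T) (x : T) : nat :=
  #|[set y | g x y]|.

Definition max_degree (T : finType) (g : rel T) : nat :=
  \max_(x : T) degree g x.

(* Least k such that some walk with k edges leads from x to y; a shortest walk
   has fewer than #|T| edges.  The value is #|T| if y is unreachable from x,
   which does not happen in a connected graph. *)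
Definition dist (T : finType) (g : rel T) (x y : T) : nat :=
  find (fun k => [exists p : k.-tuple T, path g x p && (last x p == y)])
       (iota 0 #|T|).

Definition diameter (T : finType) (g : rel T) : nat :=
  \max_(x : T) \max_(y : T) dist g x y.

(* Undirected edges are represented by their two-element sets of endpoints. *)
Definition edges (T : finType) (g : rel T) : {set {set T}} :=
  [set A : {set T} | [exists x, exists y, g x y && (A == [set x; y])]].

(* A pair (vertex set, edge set); see is_subgraph for the compatibility
   conditions. *)
Definition subgraph (T : finType) : finType := ({set T} * {set {set T}})%type.

Definition is_subgraph (T : finType) (g : rel T) (H : subgraph T) : bool :=
  (H.2 \subset edges g) && [forall A in H.2, A \subset H.1].

Definition adj (T : finType) (H : subgraph T) : rel T :=
  [rel x y | [set x; y] \in H.2].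

(* The null graph, which has no vertex at all, is not counted as a subgraph. *)
Definition degenerate (T : finType) (d : nat) (g : rel T) : Prop :=
  forall H : subgraph T, is_subgraph g H -> H.1 != set0 ->
    exists2 x, x \in H.1 & degree (adj H) x <= d.

Definition boundary (T : finType) (g : rel T) (H : subgraph T) :
    {set {set T}} :=
  [set A in edges g | #|A :&: H.1| == 1].

Definition add_edge (T : finType) (H : subgraph T) (A : {set T}) :
    subgraph T :=
  (H.1 :|: A, A |: H.2).

Definition root_tree (T : finType) (s : T) : subgraph T := ([set s], set0).

(* A leaf of a tree H rooted at s is a vertex without children: its only
   neighbour is its parent if it is not the root, and it has no neighbour if it
   is the root. *)
Definition is_leaf (T : finType) (s : T) (H : subgraph T) (x : T) : bool :=
  (x \in H.1) && (degree (adj H) x == (x != s)).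

Definition root_leaf_path (T : finType) (s : T) (H : subgraph T) (p : seq T) :
    bool :=
  [&& path (adj H) s p, uniq (s :: p) & is_leaf s H (last s p)].

(* The path s :: p has size p edges, fewer than #|T| since it is simple. *)
Definition height (T : finType) (s : T) (H : subgraph T) : nat :=
  \max_(k < #|T| | [exists p : k.-tuple T, root_leaf_path s H p]) k.

Local Open Scope ring_scope.

(* Probability that a uniformly chosen boundary edge extends H to H'. *)
Definition step_prob (R : realType) (T : finType) (g : rel T)
    (H H' : subgraph T) : R :=
  #|[set A in boundary g H | add_edge H A == H']|%:R / #|boundary g H|%:R.

(* growth_law R g s i is the law (probability mass function) of the tree
   obtained after i edge additions, which has i.+1 vertices as long as
   i < #|T| and g is connected. *)
Fixpoint growth_law (R : realType) (T : finType) (g : rel T) (s : T) (i : nat)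
    (H' : subgraph T) : R :=
  if i is j.+1
  then \sum_(H : subgraph T) growth_law R g s j H * step_prob R g H H'
  else (H' == root_tree s)%:R.

Definition spanning_tree_law (R : realType) (T : finType) (g : rel T) (s : T) :
    subgraph T -> R :=
  growth_law R g s #|T|.-1.

Definition spanning_tree_prob (R : realType) (T : finType) (g : rel T) (s : T)
    (P : pred (subgraph T)) : R :=
  \sum_(H : subgraph T | P H) spanning_tree_law R g s H.

(* Main.v *)
Require Import Defs.
From HB Require Import structures.
From mathcomp Require Import all_boot all_order all_algebra.
From mathcomp Require Import zify ring lra.
From mathcomp Require Import reals sequences exp.

(** Give every edge of the graph an independent exponential clock of rate 1 and
    let a vertex be reached at its first-passage time from s: the tree that
    grows is the random tree of the theorem, and when b edges leave the current
    tree the next vertex arrives after a mean time 1 / b.  Put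
    t := 2 D + 4 ln n.  Every vertex is likely to be reached by time t, since it
    is joined to s by a path of at most D edges; and a tree of height k reached
    by time t contains a path of k edges from s with total weight at most t,
    which is unlikely because a d-degenerate graph has few paths of length k:
    its adjacency operator has norm at most 2 sqrt (d Delta).

    The proof keeps these two estimates but replaces the random times by a
    deterministic functional of the growing tree, the clock c, which increases
    by 1 / b at each step.  Each estimate becomes a supermartingale of the
    discrete growth process.

    - Covering in time t.  Let G be the sum of 2 ^ dist(H, v) over the vertices
      v outside the current tree H.  For each such v some boundary edge brings H
      closer to v, so one step divides 2 ^ dist(H, v) by 2 with probability at
      least 1 / b, and exp (c / 2) G decreases on average
      (cover_potential_step).

    - Few long paths.  Let F be the sum, over the simple paths p of H that start
      at s, of theta ^ |p| w(end of p), with theta = 2 e.  A new tree edge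
      creates just one new simple path from s.  If the sum of w over the
      neighbours of x is at most rho w(x) for all x, then F grows on average by
      a factor at most 1 + theta rho / b, and exp (- theta rho c) F decreases on
      average (path_potential_step).  A truncated series of walk counts provides
      such a w with rho = 4 sqrt (d Delta) and values between 1 and 2 n
      (exists_vertex_weight); here degeneracy enters, through an orientation of
      out-degree at most d.

    The rate theta rho is the factor K = 8 e sqrt (d Delta) of the theorem.  If
    the final clock c is at most t and the height h exceeds K t, then F is at
    least theta ^ h, which makes exp (- K c) F / n ^ 2 at least 1
    (tall_tree_weight).  So the indicator of a tall tree is dominated by the
    final value of tail_bound, which combines the two potentials, decreases on
    average, and starts from a value of at most 3 / n. *)

Set Implicit Arguments.
Unset Strict Implicit.
Unset Printing Implicit Defensive.

Import Order.TTheory GRing.Theory Num.Theory.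
Local Open Scope ring_scope.

(** * The adjacency operator of a degenerate graph *)

Lemma edges_set2 (T : finType) (g : rel T) (x y : T) :
  simple_graph g -> ([set x; y] \in edges g) = g x y.
Proof.
move=> [gC gI]; rewrite inE; apply/idP/idP => [|gxy]; last first.
  by apply/existsP; exists x; apply/existsP; exists y; rewrite gxy eqxx.
case/existsP=> a /existsP[b /andP[gab /eqP xyab]].
have: a \in [set x; y] by rewrite xyab set21.
have: b \in [set x; y] by rewrite xyab set22.
have: x \in [set a; b] by rewrite -xyab set21.
have: y \in [set a; b] by rewrite -xyab set22.
rewrite !inE => yab xab bxy axy.
have abN : a != b by apply: contraTneq gab => ->; rewrite gI.
case/orP: axy => /eqP ax; case/orP: bxy => /eqP bx; subst.
- by rewrite eqxx in abN.
- by [].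
- by rewrite gC.
- by rewrite eqxx in abN.
Qed.

Lemma boundaryP (T : finType) (g : rel T) (H : subgraph T) (A : {set T}) :
  simple_graph g ->
  reflect (exists u v, [/\ u \in H.1, v \notin H.1, g u v & A = [set u; v]])
          (A \in boundary g H).
Proof.
move=> sg; have [gC gI] := sg; rewrite inE; apply: (iffP andP).
  case; rewrite inE => /existsP[x /existsP[y /andP[gxy /eqP ->]]] /cards1P[z Ez].
  have xy : x != y by apply: contraTneq gxy => ->; rewrite gI.
  have: z \in [set x; y] :&: H.1 by rewrite Ez set11.
  rewrite inE => /andP[zxy zH].
  have [xH|xH] := boolP (x \in H.1); last first.
    exists y, x; split=> //; [|by rewrite gC|by rewrite setUC].
    by move: zxy zH; rewrite !inE => /orP[]/eqP-> //; rewrite (negbTE xH).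
  exists x, y; split=> //; apply/negP => yH; move/eqP: xy; apply.
  have: x \in [set x; y] :&: H.1 by rewrite inE set21.
  have: y \in [set x; y] :&: H.1 by rewrite inE set22.
  by rewrite Ez !inE => /eqP-> /eqP->.
move=> [u [v [uH vH guv ->]]]; split; first by rewrite edges_set2.
apply/cards1P; exists u; apply/setP => z; rewrite !inE.
apply/idP/eqP => [/andP[/orP[]/eqP-> //]|->]; last by rewrite eqxx.
by rewrite (negbTE vH).
Qed.

(** Remove a vertex of degree at most d, orient its edges away from it, and
    recurse on the rest.  Only the vertices still present matter, hence the
    induction over vertex sets in the proof. *)
Lemma degenerate_orientation (T : finType) (g : rel T) (d : nat) :
  simple_graph g -> degenerate d g ->
  exists o : rel T, [/\ forall x y, g x y -> o x y || o y x,
    forall x y, o x y -> g x y & forall x, (#|[set y | o x y]| <= d)%N].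
Proof.
move=> sg dg; have [gC _] := sg.
suff [o [o1 o2 o3]] : exists o : rel T,
    [/\ {in [set: T] &, forall x y, g x y -> o x y || o y x},
    forall x y, o x y -> g x y & forall x, (#|[set y | o x y]| <= d)%N].
  by exists o; split=> // x y; apply: o1; rewrite inE.
have [m] := ubnP #|[set: T]|; elim: m [set: T] => // m IH S.
rewrite ltnS => leSm; have [->|S0] := eqVneq S set0.
  exists (fun _ _ => false); split=> // [x y|x]; first by rewrite inE.
  by rewrite (_ : [set _ | _] = set0) ?cards0 //; apply/setP => y; rewrite !inE.
pose H : subgraph T := (S, [set A in edges g | A \subset S]).
have /dg : is_subgraph g H.
  apply/andP; split; first by apply/subsetP => A; rewrite inE => /andP[].
  by apply/forallP => A; apply/implyP; rewrite inE => /andP[].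
case/(_ S0) => x /= xS degx.
have [|o [o1 o2 o3]] := IH (S :\ x).
  by move: leSm; rewrite (cardsD1 x S) xS add1n.
exists (fun a b => if a == x then g a b && (b \in S) else (a \in S) && o a b).
split.
- move=> a b aS bS gab; rewrite aS bS /= andbT.
  have [ax|ax] := eqVneq a x; first by rewrite gab.
  have [bx|bx] := eqVneq b x; first by rewrite gC gab orbT.
  by apply: o1 => //; rewrite !inE ?ax ?bx.
- by move=> a b; case: eqP => _ /andP[]// _ /o2.
- move=> a; have [->|ax] := eqVneq a x.
    apply: leq_trans degx; apply: subset_leq_card; apply/subsetP => y.
    rewrite inE => /andP[gxy yS]; rewrite inE /adj /= inE edges_set2 // gxy /=.
    by apply/subsetP => z /set2P[]->.
  apply: leq_trans (o3 a); apply: subset_leq_card; apply/subsetP => y.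
  by rewrite !inE => /andP[].
Qed.

Lemma sqr_sum_le (R : realFieldType) (T : finType) (S : {set T}) (f : T -> R) :
  (\sum_(i in S) f i) ^+ 2 <= #|S|%:R * \sum_(i in S) f i ^+ 2 :> R.
Proof.
have -> : #|S|%:R * \sum_(i in S) f i ^+ 2 =
    \sum_(i in S) \sum_(j in S) (f i ^+ 2 + f j ^+ 2) / 2.
  have E i : \sum_(j in S) (f i ^+ 2 + f j ^+ 2) / 2 =
      (f i ^+ 2 *+ #|S| + \sum_(j in S) f j ^+ 2) / 2.
    by rewrite -mulr_suml big_split sumr_const.
  rewrite (eq_bigr _ (fun i _ => E i)) -mulr_suml big_split /= sumr_const.
  by rewrite sumrMnl -mulr_natl; field.
rewrite expr2 mulr_suml; apply: ler_sum => i _.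
rewrite mulr_sumr; apply: ler_sum => j _.
have := sqr_ge0 (f i - f j); nra.
Qed.

(** Schur's test: the l2 norm of a 0-1 matrix is at most the geometric mean of
    its largest row sum and its largest column sum. *)
Lemma relation_l2 (R : realFieldType) (T : finType) (o : rel T) (a b : nat)
    (f : T -> R) :
  (forall x, #|[set y | o x y]| <= a)%N ->
  (forall y, #|[set x | o x y]| <= b)%N ->
  \sum_x (\sum_(y | o x y) f y) ^+ 2 <= (a * b)%:R * \sum_x f x ^+ 2 :> R.
Proof.
move=> oa ob.
have le1 x : (\sum_(y | o x y) f y) ^+ 2 <= a%:R * \sum_(y | o x y) f y ^+ 2 :> R.
  have E (h : T -> R) : \sum_(y | o x y) h y = \sum_(y in [set y | o x y]) h y.
    by apply: eq_bigl => y; rewrite inE.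
  rewrite !E; apply: le_trans (sqr_sum_le _ _) _; 
  apply: ler_wpM2r; last by rewrite ler_nat.
  by apply: sumr_ge0 => y _; apply: sqr_ge0.
apply: le_trans (ler_sum _ (fun x _ => le1 x)) _.
rewrite -mulr_sumr natrM -mulrA; apply: ler_wpM2l => //.
rewrite (exchange_big_dep xpredT) //= mulr_sumr; apply: ler_sum => y _.
rewrite sumr_const -[_ *+ _]mulr_natl; apply: ler_wpM2r; first exact: sqr_ge0.
by have := ob y; rewrite cardsE ler_nat.
Qed.

Lemma degree_le_max (T : finType) (g : rel T) (x : T) :
  (degree g x <= max_degree g)%N.
Proof. exact: (leq_bigmax x). Qed.

(** The adjacency matrix is at most B + B^T, where B is the matrix of an
    orientation of out-degree at most d.  Both summands have norm at most
    sqrt (d Delta), and the factor 4 is (1 + 1) ^ 2. *)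
Lemma degenerate_l2 (R : realFieldType) (T : finType) (g : rel T) (d : nat)
    (f : T -> R) :
  simple_graph g -> degenerate d g -> (forall x, 0 <= f x) ->
  \sum_x (\sum_(y | g x y) f y) ^+ 2 <=
    4 * (d * max_degree g)%:R * \sum_x f x ^+ 2 :> R.
Proof.
move=> sg dg f0; have [gC _] := sg.
have [o [go og od]] := degenerate_orientation sg dg.
have oD y : (#|[set x | o x y]| <= max_degree g)%N.
  apply: leq_trans (degree_le_max g y); apply: subset_leq_card.
  by apply/subsetP => x; rewrite !inE gC => /og.
pose Out x := \sum_(y | o x y) f y; pose In x := \sum_(y | o y x) f y.
have le_out : \sum_x Out x ^+ 2 <= (d * max_degree g)%:R * \sum_x f x ^+ 2.
  exact: relation_l2.
have le_in : \sum_x In x ^+ 2 <= (d * max_degree g)%:R * \sum_x f x ^+ 2.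
  by rewrite mulnC; apply: relation_l2.
have le_io x : (\sum_(y | g x y) f y) ^+ 2 <= 2 * Out x ^+ 2 + 2 * In x ^+ 2 :> R.
  have : \sum_(y | g x y) f y <= Out x + In x.
    rewrite /Out /In big_mkcond [X in _ <= X + _]big_mkcond.
    rewrite [X in _ <= _ + X]big_mkcond -big_split /=; apply: ler_sum => y _.
    have := go x y; have := f0 y.
    case: (g x y); case: (o x y); case: (o y x) => //= fy H;
      rewrite ?addr0 ?add0r ?lerDl ?addr_ge0 //.
    by have := H isT.
  have : 0 <= \sum_(y | g x y) f y by apply: sumr_ge0.
  have := sqr_ge0 (Out x - In x); nra.
apply: le_trans (ler_sum _ (fun x _ => le_io x)) _.
rewrite big_split /= -!mulr_sumr -mulrA.
by move: le_out le_in; set S := _%:R * _; lra.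
Qed.

(** The number of walks of length j from x, divided by rho ^ j. *)
Definition walk_mass (R : realFieldType) (T : finType) (g : rel T) (rho : R)
    (j : nat) : T -> R :=
  iter j (fun f x => (\sum_(y | g x y) f y) / rho) (fun=> 1).

Lemma walk_mass_ge0 (R : realFieldType) (T : finType) (g : rel T) (rho : R)
    (j : nat) (x : T) : 0 <= rho -> 0 <= walk_mass g rho j x.
Proof.
move=> rho0; elim: j x => [|j IH] x /=; first exact: ler01.
by rewrite divr_ge0 ?sumr_ge0.
Qed.

(** The number rho is twice the bound 2 sqrt (d Delta) on the norm of the
    adjacency matrix, so each step divides the squared norm by 4. *)
Lemma walk_mass_l2 (R : realFieldType) (T : finType) (g : rel T) (d : nat)
    (rho : R) (j : nat) :
  simple_graph g -> degenerate d g -> 0 < rho ->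
  rho ^+ 2 = 16 * (d * max_degree g)%:R ->
  \sum_x walk_mass g rho j x ^+ 2 <= #|T|%:R / 4 ^+ j.
Proof.
move=> sg dg rho0 rho2; elim: j => [|j IH] /=.
  by rewrite (eq_bigr (fun=> 1)) ?sumr_const ?divr1 // => x _; rewrite expr1n.
under eq_bigr do rewrite expr_div_n.
rewrite -mulr_suml ler_pdivrMr ?exprn_gt0 // rho2.
apply: le_trans (degenerate_l2 sg dg (fun x => walk_mass_ge0 g j x (ltW rho0))) _.
have -> : #|T|%:R / 4 ^+ j.+1 * (16 * (d * max_degree g)%:R) =
    4 * (d * max_degree g)%:R * (#|T|%:R / 4 ^+ j) :> R.
  by rewrite exprS; field; rewrite expf_neq0 ?pnatr_eq0.
by apply: (ler_wpM2l _ IH); rewrite mulr_ge0.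
Qed.

Lemma walk_mass_le (R : realFieldType) (T : finType) (g : rel T) (d : nat)
    (rho : R) (j : nat) (x : T) :
  simple_graph g -> degenerate d g -> 0 < rho ->
  rho ^+ 2 = 16 * (d * max_degree g)%:R ->
  walk_mass g rho j x <= #|T|%:R / 2 ^+ j.
Proof.
move=> sg dg rho0 rho2.
have m0 := walk_mass_ge0 g j x (ltW rho0).
have T1 : (1 <= #|T|)%N by apply/card_gt0P; exists x.
rewrite -(@ler_pXn2r _ 2) ?nnegrE ?divr_ge0 ?exprn_ge0 //.
apply: le_trans (le_trans _ (walk_mass_l2 j sg dg rho0 rho2)) _.
  by rewrite (bigD1 x) //= lerDl sumr_ge0 // => y _; apply: sqr_ge0.
rewrite expr_div_n -exprM mulnC exprM (_ : 2 ^+ 2 = 4); last by ring.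
apply: ler_wpM2r; first by rewrite invr_ge0 exprn_ge0.
by rewrite -natrX ler_nat leq_pmulr.
Qed.

(** The sum of walk_mass over all lengths would be an exact solution of
    A w = rho (w - 1).  Cutting it after #|T| terms adds rho times the next
    term to the right-hand side, and that term is at most n / 2 ^ n <= 1, which
    the - 1 absorbs. *)
Lemma exists_vertex_weight (R : realFieldType) (T : finType) (g : rel T)
    (d : nat) (rho : R) :
  simple_graph g -> degenerate d g -> 0 < rho ->
  rho ^+ 2 = 16 * (d * max_degree g)%:R ->
  exists w : T -> R, [/\ forall x, 1 <= w x,
    forall x, \sum_(y | g x y) w y <= rho * w x & 
    forall x, w x <= 2 * #|T|%:R].
Proof.
move=> sg dg rho0 rho2; pose mass := walk_mass g rho.
have mass0 j x : 0 <= mass j x by apply: walk_mass_ge0; apply: ltW.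
have mass_le j x : mass j x <= #|T|%:R / 2 ^+ j by apply: (walk_mass_le _ _ sg dg).
exists (fun x => \sum_(j < #|T|) mass j x); split=> x.
- have T1 : (0 < #|T|)%N by apply/card_gt0P; exists x.
 rewrite (bigD1 (Ordinal T1)) //=. by rewrite lerDl sumr_ge0.
- rewrite exchange_big /=.
  have E j : \sum_(y | g x y) mass j y = rho * mass j.+1 x.
    by rewrite mulrC /mass /= divfK ?gt_eqF.
  rewrite (eq_bigr _ (fun (j : 'I__) _ => E j)) -mulr_sumr ler_pM2l //.
  have: \sum_(j < #|T|.+1) mass j x = \sum_(j < #|T|.+1) mass j x by [].
  rewrite {1}big_ord_recl big_ord_recr /= => S.
  have : mass #|T| x <= 1.
    apply: le_trans (mass_le _ _) _.
    rewrite ler_pdivrMr ?exprn_gt0 // mul1r -natrX ler_nat.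
    by apply: ltnW; apply: ltn_expl.
  move: S; rewrite /bump /=; lra.
- apply: (@le_trans _ _ (\sum_(j < #|T|) #|T|%:R / 2 ^+ j)).
    by apply: ler_sum.
  have -> : forall m, \sum_(j < m) #|T|%:R / 2 ^+ j =
      2 * #|T|%:R - 2 * #|T|%:R / 2 ^+ m :> R.
    elim=> [|m IH]; first by rewrite big_ord0 divr1 subrr.
    by rewrite big_ord_recr /= IH exprS; field; rewrite expf_neq0 ?pnatr_eq0.
  by rewrite gerBl divr_ge0 ?mulr_ge0 ?exprn_ge0.
Qed.

(** * Distances and the covering of the graph *)

(** The second vertex of a shortest walk is one step closer to its end. *)
Lemma dist_step (T : finType) (g : rel T) (x v : T) :
  connected_graph g -> x != v -> exists2 y, g x y & (dist g y v < dist g x v)%N.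
Proof.
move=> gconn xv.
pose walk x := fun k => [exists p : k.-tuple T, path g x p && (last x p == v)].
have walkP x' (p : seq T) : path g x' p -> last x' p = v -> walk x' (size p).
  by move=> pp lp; apply/existsP; exists (in_tuple p); rewrite pp lp eqxx.
have : has (walk x) (iota 0 #|T|).
  have /connectP[p0 pp0 lp0] := gconn x v; case/shortenP: pp0 lp0 => p pp up _ lp.
  apply/hasP; exists (size p); last exact: walkP.
  rewrite mem_iota add0n; have := max_card [in x :: p].
  by rewrite (card_uniqP up).
rewrite -/(dist g x v) => hx; have := nth_find 0%N hx.
have := hx; rewrite has_find size_iota => ltd.
rewrite nth_iota // add0n => /existsP[p] /andP[].
have sp : size p = find (walk x) (iota 0 #|T|) by rewrite size_tuple.
case: (tval p) sp => [|y q] sp /=; first by move=> _ /eqP E; rewrite E eqxx in xv.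
move=> /andP[gxy pq] /eqP lq; exists y => //.
rewrite /dist -/(walk x) -/(walk y) -sp /= ltnS leqNgt; apply/negP => lt.
have := before_find 0%N lt; rewrite nth_iota.
  by rewrite add0n (walkP _ _ pq lq).
by apply: ltn_trans ltd; rewrite -sp.
Qed.

(** The distance from S to v.  The default s of the minimum is an element of S
    in all uses below. *)
Definition set_dist (T : finType) (g : rel T) (s : T) (S : {set T}) (v : T) :
    nat :=
  dist g [arg min_(u < s in S) dist g u v] v.

Lemma set_dist_le (T : finType) (g : rel T) (s : T) (S : {set T}) (u v : T) :
  s \in S -> u \in S -> (set_dist g s S v <= dist g u v)%N.
Proof. by rewrite /set_dist => sS; case: arg_minnP => // x xS; apply. Qed.

Lemma set_dist_attained (T : finType) (g : rel T) (s : T) (S : {set T})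
    (v : T) :
  s \in S -> exists2 u, u \in S & set_dist g s S v = dist g u v.
Proof. by rewrite /set_dist => sS; case: arg_minnP => // x xS _; exists x. Qed.

Lemma boundary_closer (T : finType) (g : rel T) (s : T) (H : subgraph T)
    (v : T) :
  simple_graph g -> connected_graph g -> s \in H.1 -> v \notin H.1 ->
  exists2 A, A \in boundary g H &
    (set_dist g s (add_edge H A).1 v < set_dist g s H.1 v)%N.
Proof.
move=> sg gconn sH vH; have [u uH Ed] := set_dist_attained g v sH.
have uv : u != v by apply: contraTneq uH => ->.
have [y guy lty] := dist_step gconn uv.
have yH : y \notin H.1.
  by apply: contraTN lty => yH; rewrite -leqNgt -Ed set_dist_le.
exists [set u; y]; first by apply/(boundaryP _ _ sg); exists u, y.
rewrite Ed; apply: leq_ltn_trans lty.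
by apply: set_dist_le; rewrite !inE ?sH ?eqxx ?orbT.
Qed.

Definition cover_potential (R : realFieldType) (T : finType) (g : rel T)
    (s : T) (S : {set T}) : R :=
  \sum_(v in ~: S) 2 ^+ set_dist g s S v.

Lemma cover_potential_ge0 (R : realFieldType) (T : finType) (g : rel T)
    (s : T) (S : {set T}) : 0 <= cover_potential R g s S.
Proof. by apply: sumr_ge0 => v _; rewrite exprn_ge0. Qed.

Lemma cover_potential_root (R : realFieldType) (T : finType) (g : rel T)
    (s : T) :
  cover_potential R g s [set s] <= #|T|%:R * 2 ^+ diameter g.
Proof.
apply: (@le_trans _ _ (\sum_(v : T) 2 ^+ diameter g)).
  rewrite /cover_potential big_mkcond; apply: ler_sum => v _.
  case: ifP => _; last by rewrite exprn_ge0.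
  rewrite ler_eXn2l ?ltr1n //.
  apply: leq_trans (set_dist_le g v (set11 s) (set11 s)) _.
  by rewrite /diameter; apply: leq_trans (leq_bigmax s); apply: leq_bigmax.
by rewrite sumr_const mulr_natl.
Qed.

(** For each v outside the tree, one of the b boundary edges at least halves its
    term and the others do not increase it, so its b new values sum to at most
    b - 1 / 2 times the old one.  The vertex that enters the tree still counts
    with 2 ^ 0 = 1 in this argument, which leaves the summand 1.  This unit pays
    for a clock that passes t at the same step; at the last step it is all that
    is left, since cover_potential vanishes on a spanning tree. *)
Lemma cover_potential_step (R : realFieldType) (T : finType) (g : rel T)
    (s : T) (H : subgraph T) :
  simple_graph g -> connected_graph g -> s \in H.1 ->
  \sum_(A in boundary g H) (1 + cover_potential R g s (add_edge H A).1) <=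
    (#|boundary g H|%:R - 2^-1) * cover_potential R g s H.1.
Proof.
move=> sg gconn sH.
pose d A v : R := 2 ^+ set_dist g s (H.1 :|: A) v.
have d_ge1 A v : 1 <= d A v by rewrite exprn_ege1 // ler1n.
have mono A v : d A v <= 2 ^+ set_dist g s H.1 v.
  rewrite ler_eXn2l ?ltr1n //; have [u uH ->] := set_dist_attained g v sH.
  by apply: set_dist_le; rewrite inE ?sH ?uH.
have covered A : A \in boundary g H ->
    1 + cover_potential R g s (add_edge H A).1 <= \sum_(v in ~: H.1) d A v.
  case/(boundaryP _ _ sg) => u [x [uH xH gux EA]].
  have -> : cover_potential R g s (add_edge H A).1 =
      \sum_(v in ~: H.1 | v != x) d A v.
    apply: eq_bigl => v; rewrite EA !inE !negb_or; case vH: (v \in H.1) => //=.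
    by case: (eqVneq v u) => // vu; rewrite vu uH in vH.
  by rewrite [leRHS](bigD1 x) ?inE //= lerD.
apply: le_trans (ler_sum _ covered) _.
rewrite exchange_big /= mulr_sumr; apply: ler_sum => v; rewrite inE => vH.
have [A AH closer] := boundary_closer sg gconn sH vH.
rewrite (bigD1 A AH) /=.
have dA : d A v <= 2 ^+ set_dist g s H.1 v / 2.
  by rewrite ler_pdivlMr // -exprSr ler_eXn2l ?ltr1n.
have : \sum_(B in boundary g H | B != A) d B v <=
    (#|boundary g H|%:R - 1) * 2 ^+ set_dist g s H.1 v.
  apply: le_trans (ler_sum _ (fun B _ => mono B v)) _.
  rewrite (eq_bigl [in boundary g H :\ A]) => [|B]; last first.
    by rewrite !inE andbC.
  rewrite sumr_const [in leRHS](cardsD1 A) AH natrD [1 + _]addrC addrK.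
  by rewrite mulr_natl.
lra.
Qed.

(** * Paths from the root *)

Lemma ler_sum_inj (R : numDomainType) (I J : finType) (P : pred I) (Q : pred J)
    (h : I -> J) (F : I -> R) (G : J -> R) :
  (forall i, P i -> Q (h i)) -> {in P &, injective h} ->
  (forall i, P i -> F i <= G (h i)) -> (forall j, Q j -> 0 <= G j) ->
  \sum_(i | P i) F i <= \sum_(j | Q j) G j.
Proof.
move=> PQ hI FG G0; rewrite (partition_big h Q) //=; apply: ler_sum => j Qj.
have [i /andP[Pi /eqP <-]|nPj] := pickP [pred i | P i && (h i == j)].
  rewrite (big_pred1 i) ?FG // => i' /=.
  apply/andP/eqP => [[Pi' /eqP]|->]; first exact: hI.
  by rewrite eqxx.
by rewrite big_pred0 ?G0.
Qed.

(** The part of being a tree rooted at s that the argument needs: a vertex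
    outside H is isolated in H, so the edge that attaches it makes it a leaf. *)
Definition rooted (T : finType) (s : T) (H : subgraph T) : bool :=
  (s \in H.1) && [forall A in H.2, A \subset H.1].

Lemma rooted_root_tree (T : finType) (s : T) : rooted s (root_tree s).
Proof. by rewrite /rooted set11; apply/forall_inP => A; rewrite inE. Qed.

Lemma rooted_add_edge (T : finType) (s : T) (H : subgraph T) (A : {set T}) :
  rooted s H -> rooted s (add_edge H A).
Proof.
case/andP=> sH /forall_inP HH; rewrite /rooted inE sH /=.
apply/forall_inP => B; rewrite !inE => /orP[/eqP->|/HH BH].
  exact: subsetUr.
by apply: subset_trans BH _; apply: subsetUl.
Qed.

Definition root_path (T : finType) (s : T) (H : subgraph T) (p : seq T) : bool :=
  path (adj H) s p && uniq (s :: p).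

Lemma root_path_size (T : finType) (s : T) (H : subgraph T) (p : seq T) :
  root_path s H p -> (size p < #|T|)%N.
Proof.
by case/andP=> _ up; have := max_card [in s :: p]; rewrite (card_uniqP up).
Qed.

(** The new vertex v has u as its only neighbour, so a simple path can visit v
    only as its last vertex, right after u. *)
Lemma root_path_add_edge (T : finType) (s : T) (H : subgraph T) (u v : T)
    (p : seq T) :
  rooted s H -> v \notin H.1 ->
  root_path s (add_edge H [set u; v]) p ->
  root_path s H p \/
  exists q, [/\ p = rcons q v, last s q = u & root_path s H q].
Proof.
move=> /andP[sH /forall_inP HH] vH.
have sv : s != v by apply: contraTneq sH => ->.
have old x y : x != v -> y != v -> adj (add_edge H [set u; v]) x y -> adj H x y.
  move=> xv yv; rewrite /adj /= !inE => /orP[/eqP E|//].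
  by have := set22 u v; rewrite -E !inE ![v == _]eq_sym (negbTE xv) (negbTE yv).
have new x : x != v ->
    adj (add_edge H [set u; v]) x v || adj (add_edge H [set u; v]) v x -> x = u.
  have vx_old : [set x; v] \notin H.2.
    by apply: contra vH => /HH /subsetP; apply; rewrite set22.
  rewrite /adj /= [in X in _ || X]setUC orbb !inE (negbTE vx_old) orbF.
  move=> xv /eqP E; have := set21 x v; rewrite E !inE (negbTE xv) orbF.
  by move/eqP.
have old_path x q : x != v -> v \notin q ->
    path (adj (add_edge H [set u; v])) x q -> path (adj H) x q.
  elim: q x => //= y q IH x xv; rewrite inE negb_or => /andP[vy vq].
  case/andP=> xy yq; rewrite eq_sym in vy.
  by rewrite old //= IH.
case/andP=> pp up; have [vp|vp] := boolP (v \in p); last first.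
  by left; rewrite /root_path up andbT old_path.
right; case/splitPr: vp pp up => p1 p2; rewrite cat_path -cat_cons cat_uniq.
move=> /= /andP[pp1 /andP[lv vp2]] /and3P[/andP[sp1 up1]].
rewrite negb_or => /andP[vsp1 p2sp1] /andP[vp2' _].
have lv1 : last s p1 != v by apply: contraNneq vsp1 => <-; rewrite mem_last.
have lu : last s p1 = u by apply: new => //; rewrite lv.
have vp1 : v \notin p1 by move: vsp1; rewrite inE negb_or => /andP[].
have rp1 : root_path s H p1 by rewrite /root_path /= sp1 up1 old_path.
case: p2 vp2 p2sp1 vp2' => [|y p2] /=; first by exists p1; rewrite cats1.
move=> /andP[vy _] /norP[yp1 _]; rewrite inE => /norP[vyN _].
case/negP: yp1; rewrite (new y) ?vy ?orbT // 1?eq_sym // -lu.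
exact: mem_last.
Qed.

(** In a tree this is the sum of theta ^ depth(x) * w(x) over its vertices x.
    Summing over simple paths expresses it through H alone, without a depth
    function that would have to be carried along with the process. *)
Definition path_potential (R : realFieldType) (T : finType) (s : T)
    (theta : R) (w : T -> R) (H : subgraph T) : R :=
  \sum_(p : #|T|.-bseq T | root_path s H p) theta ^+ size p * w (last s p).

Lemma path_potential_ge0 (R : realFieldType) (T : finType) (s : T)
    (theta : R) (w : T -> R) (H : subgraph T) :
  0 <= theta -> (forall x, 0 <= w x) -> 0 <= path_potential s theta w H.
Proof. by move=> t0 w0; apply: sumr_ge0 => p _; rewrite mulr_ge0 ?exprn_ge0. Qed.

Lemma path_potential_ge (R : realFieldType) (T : finType) (s : T)
    (theta : R) (w : T -> R) (H : subgraph T) (p : seq T) :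
  0 <= theta -> (forall x, 1 <= w x) -> root_path s H p ->
  theta ^+ size p <= path_potential s theta w H.
Proof.
move=> t0 w1 rp; have w0 x : 0 <= w x by apply: le_trans (w1 x).
rewrite /path_potential.
rewrite (bigD1 (Bseq (ltnW (root_path_size rp)))) //=.
apply: le_trans (_ : theta ^+ size p * w (last s p) <= _).
  by rewrite ler_peMr ?exprn_ge0.
by rewrite lerDl sumr_ge0 // => q _; rewrite mulr_ge0 ?exprn_ge0.
Qed.

Lemma path_potential_root (R : realFieldType) (T : finType) (s : T)
    (theta : R) (w : T -> R) :
  path_potential s theta w (root_tree s) = w s.
Proof.
rewrite /path_potential (big_pred1 [bseq]) /= ?mul1r // => p /=.
apply/idP/eqP => [/andP[pp _]|-> //]; apply: val_inj => /=.
by case: (bseqval p) pp => //= x q /andP[]; rewrite /adj /= inE.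
Qed.

(** The inner sum lets the new vertex x range over all vertices; it has at most
    one term, but in this form it can be exchanged with the sum over A. *)
Lemma path_potential_add_edge (R : realFieldType) (T : finType) (g : rel T)
    (s : T) (theta : R) (w : T -> R) (H : subgraph T) (A : {set T}) :
  simple_graph g -> 0 <= theta -> (forall x, 0 <= w x) -> rooted s H ->
  A \in boundary g H ->
  path_potential s theta w (add_edge H A) <= path_potential s theta w H +
    \sum_(q : #|T|.-bseq T | root_path s H q)
      \sum_(x | A == [set last s q; x]) theta ^+ (size q).+1 * w x.
Proof.
move=> sg t0 w0 rH /(boundaryP _ _ sg)[u [v [uH vH guv ->]]].
have t_ge0 k x : 0 <= theta ^+ k * w x by rewrite mulr_ge0 ?exprn_ge0.
rewrite {1}/path_potential (bigID (fun p : _.-bseq _ => root_path s H p)) /=.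
apply: lerD.
  rewrite /path_potential big_mkcond [leRHS]big_mkcond; apply: ler_sum => p _.
  by case: (root_path s H p); rewrite ?andbF // andbT; case: ifP.
rewrite pair_big_dep /=.
(* A new path is determined by its last vertex and the path before it. *)
pose cut (p : #|T|.-bseq T) := ([bseq of take (size p).-1 p], last s p).
have new_path (p : #|T|.-bseq T) :
    root_path s (add_edge H [set u; v]) p && ~~ root_path s H p ->
    [/\ p = rcons (cut p).1 (cut p).2 :> seq T, (cut p).2 = v,
       last s (cut p).1 = u & root_path s H (cut p).1].
  case/andP=> /(root_path_add_edge rH vH)[->//|[q [Ep lq rq]] _].
  by rewrite /cut /= Ep size_rcons /= last_rcons -cats1 take_size_cat // cats1.
apply: (ler_sum_inj (h := cut)) => [p|p p'|p|[q x] _] //=.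
- by case/new_path=> _ /= -> -> ->; rewrite eqxx.
- move=> /new_path[Ep _ _ _] /new_path[Ep' _ _ _] E.
  by apply: val_inj => /=; rewrite Ep Ep' E.
- by case/new_path=> {1}-> _ _ _; rewrite size_rcons.
Qed.

(** Each path q can be prolonged only by edges of g at its end.  Summed over the
    boundary, the new paths therefore weigh at most
    theta ^ (|q| + 1) * rho * w(end of q) for each old path q. *)
Lemma path_potential_step (R : realFieldType) (T : finType) (g : rel T)
    (s : T) (theta rho : R) (w : T -> R) (H : subgraph T) :
  simple_graph g -> 0 <= theta -> (forall x, 0 <= w x) ->
  (forall x, \sum_(y | g x y) w y <= rho * w x) -> rooted s H ->
  \sum_(A in boundary g H) path_potential s theta w (add_edge H A) <=
    (#|boundary g H|%:R + theta * rho) * path_potential s theta w H.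
Proof.
move=> sg t0 w0 wrho rH.
apply: le_trans (ler_sum _ (fun A => path_potential_add_edge sg t0 w0 rH)) _.
rewrite big_split /= sumr_const mulrDl mulr_natl lerD2l.
rewrite exchange_big /= /path_potential mulr_sumr; apply: ler_sum => q _.
have t_ge0 k x : 0 <= theta ^+ k * w x by rewrite mulr_ge0 ?exprn_ge0.
rewrite (exchange_big_dep xpredT) //=.
apply: (@le_trans _ _ (\sum_(x | g (last s q) x) theta ^+ (size q).+1 * w x)).
  rewrite [leRHS]big_mkcond; apply: ler_sum => x _.
  have [gx|gx] := boolP (g _ x).
    rewrite big_mkcondr; set t := theta ^+ _ * _.
    have [Abd|Abd] := boolP ([set last s q; x] \in boundary g H).
      rewrite (bigD1 _ Abd) /= eqxx big1 ?addr0 // => A /andP[_ /negbTE->//].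
    rewrite big1 ?t_ge0 // => A; case: eqP => // ->.
    by rewrite (negbTE Abd).
  rewrite big_pred0 // => A; apply/negP => /andP[]; rewrite inE => /andP[].
  by move=> /[swap] _ /[swap] /eqP ->; rewrite edges_set2 // (negbTE gx).
have -> : theta * rho * (theta ^+ size q * w (last s q)) =
    theta ^+ (size q).+1 * (rho * w (last s q)) by rewrite exprS; ring.
by rewrite -mulr_sumr; apply: ler_wpM2l; rewrite ?exprn_ge0.
Qed.

Lemma height_attained (T : finType) (s : T) (H : subgraph T) :
  (0 < height s H)%N -> exists2 p, root_path s H p & size p = height s H.
Proof.
pose P (k : 'I_#|T|) := [exists p : k.-tuple T, root_leaf_path s H p].
have [k0 Pk0 _|noP] := pickP P; last by rewrite /height big_pred0.
rewrite /height (bigop.bigmax_eq_arg k0) //; case: arg_maxnP => // k.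
case/existsP=> p /and3P[pp up _] _; exists p; last exact: size_tuple.
by rewrite /root_path pp up.
Qed.

(** * The growth process and its clock *)

(** The transition operator of the growth process, acting on functions. *)
Definition growth_step (R : realFieldType) (T : finType) (g : rel T)
    (phi : subgraph T -> R) (H : subgraph T) : R :=
  (\sum_(A in boundary g H) phi (add_edge H A)) / #|boundary g H|%:R.

(** The backward equation: the forward recursion on laws is exchanged for
    iterates of the transition operator on a function. *)
Lemma growth_law_iter (R : realType) (T : finType) (g : rel T) (s : T) (i : nat)
    (phi : subgraph T -> R) :
  \sum_H growth_law R g s i H * phi H =
  iter i (growth_step g) phi (root_tree s).
Proof.
elim: i phi => [|i IH] phi /=.
  rewrite (bigD1 (root_tree s)) //= eqxx mul1r big1 ?addr0 // => H /negbTE->.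
  by rewrite mul0r.
rewrite -iterS iterSr -IH.
under eq_bigr do rewrite mulr_suml.
rewrite exchange_big /=; apply: eq_bigr => H _.
under eq_bigr do rewrite -mulrA.
rewrite -mulr_sumr; congr (_ * _); rewrite /growth_step /step_prob.
under eq_bigr do rewrite mulrAC.
rewrite -mulr_suml (partition_big (add_edge H) xpredT) //=; congr (_ / _).
apply: eq_bigr => H' _; rewrite (eq_bigr (fun=> phi H')) => [|A /andP[_ /eqP->//]].
by rewrite sumr_const mulr_natl -cardsE.
Qed.

Lemma spanning_tree_probE (R : realType) (T : finType) (g : rel T) (s : T)
    (P : pred (subgraph T)) :
  spanning_tree_prob R g s P =
  iter #|T|.-1 (growth_step g) (fun H => (P H)%:R) (root_tree s).
Proof.
rewrite -growth_law_iter /spanning_tree_prob big_mkcond; apply: eq_bigr => H _.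
by case: (P H); rewrite ?mulr1 ?mulr0.
Qed.

Lemma growth_iter_ge0 (R : realFieldType) (T : finType) (g : rel T) (i : nat)
    (phi : subgraph T -> R) (H : subgraph T) :
  (forall H, 0 <= phi H) -> 0 <= iter i (growth_step g) phi H.
Proof.
by move=> phi0; elim: i H => //= i IH H; rewrite /growth_step divr_ge0 ?sumr_ge0.
Qed.

Lemma card_add_boundary_edge (T : finType) (g : rel T) (H : subgraph T)
    (A : {set T}) :
  simple_graph g -> A \in boundary g H -> #|(add_edge H A).1| = #|H.1|.+1.
Proof.
move=> sg /(boundaryP _ _ sg)[u [v [uH vH _ ->]]] /=.
rewrite [_ :|: _](_ : _ = v |: H.1) ?cardsU1 ?vH //.
by apply/setP => x; rewrite !inE;
  case: (eqVneq x u) => [->|_]; rewrite ?uH ?orbT // orbC.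
Qed.

(** A submartingale that ends below phi starts below the mean of phi.  Here it
    may depend on the clock, which is a function of the whole history; since phi
    does not see the clock, c can be a parameter that is universally quantified
    in the induction, and no joint law of tree and clock is involved. *)
Lemma clocked_growth_bound (R : realFieldType) (T : finType) (g : rel T) (s : T)
    (phi : subgraph T -> R) (psi : subgraph T -> R -> R) :
  simple_graph g -> connected_graph g ->
  (forall H c, rooted s H -> (0 < #|boundary g H|)%N ->
    #|boundary g H|%:R * psi H c <=
      \sum_(A in boundary g H) psi (add_edge H A) (c + #|boundary g H|%:R^-1)) ->
  (forall H c, rooted s H -> psi H c <= phi H) ->
  forall c, psi (root_tree s) c <= iter #|T|.-1 (growth_step g) phi (root_tree s).
Proof.
move=> sg gconn step base c.
have T0 : (0 < #|T|)%N by apply/card_gt0P; exists s.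
have : (#|T|.-1 + #|(root_tree s).1| = #|T|)%N by rewrite cards1 addn1 prednK.
elim: #|T|.-1 (root_tree s) c (rooted_root_tree s) => [|i IH] H c rH cardH /=.
  exact: base.
have sH : s \in H.1 by case/andP: rH.
have b0 : (0 < #|boundary g H|)%N.
  have /card_gt0P[v] : (0 < #|~: H.1|)%N.
    by rewrite -(ltn_add2l #|H.1|) cardsC addn0 -cardH addSn ltnS leq_addl.
  rewrite inE => vH; have [A AH _] := boundary_closer sg gconn sH vH.
  by apply/card_gt0P; exists A.
rewrite /growth_step ler_pdivlMr ?ltr0n // mulrC.
apply: le_trans (step H c rH b0) _; apply: ler_sum => A AH.
by apply: IH; rewrite ?rooted_add_edge // (card_add_boundary_edge sg AH) addnS.
Qed.

(** In the main proof, an upper bound for the probability that the process,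
    from tree H and clock c on, ends with a clock above t or with a tall tree.
    The cover term controls the first event, given that c <= t, and the path
    term the second; exp (- a) normalizes the latter and will be 1 / n ^ 2. *)
Definition tail_bound (R : realType) (T : finType) (g : rel T) (s : T)
    (w : T -> R) (theta lambda a t : R) (H : subgraph T) (c : R) : R :=
  (t < c)%R%:R + expR ((c - t) / 2) * cover_potential R g s H.1 +
  expR (- (lambda * c) - a) * path_potential s theta w H.

(** With a clock that advances by 1 / b, both potentials are paid for by
    1 + x <= exp x: the factor 1 - 1 / (2 b) cancels exp (1 / (2 b)), and
    1 + theta rho / b is cancelled by exp (- theta rho / b). *)
Lemma tail_bound_step (R : realType) (T : finType) (g : rel T) (s : T)
    (w : T -> R) (theta rho a t : R) (H : subgraph T) (c : R) :
  simple_graph g -> connected_graph g -> 0 <= theta ->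
  (forall x, 0 <= w x) -> (forall x, \sum_(y | g x y) w y <= rho * w x) ->
  rooted s H -> (0 < #|boundary g H|)%N ->
  \sum_(A in boundary g H) tail_bound g s w theta (theta * rho) a t
      (add_edge H A) (c + #|boundary g H|%:R^-1) <=
  #|boundary g H|%:R * tail_bound g s w theta (theta * rho) a t H c.
Proof.
move=> sg gconn t0 w0 wrho rH b0; have sH : s \in H.1 by case/andP: rH.
have := cover_potential_step R sg gconn sH.
have := path_potential_step sg t0 w0 wrho rH.
have F0 := path_potential_ge0 s H t0 w0.
have G0 := cover_potential_ge0 R g s H.1.
rewrite /tail_bound.
set b : R := #|boundary g H|%:R; set c' := c + b^-1.
set F := path_potential _ _ _ _ in F0 *; set G := cover_potential _ _ _ _ in G0 *.
set lambda := theta * rho => stepF stepG.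
have b_gt0 : 0 < b by rewrite ltr0n.
(* At a step where the clock passes t, the new exponential is at least 1. *)
have late : (t < c')%R%:R <= (t < c)%R%:R + expR ((c' - t) / 2) :> R.
  have [tc'|_] := boolP (t < c'); last by rewrite addr_ge0 ?expR_ge0.
  have : 1 <= expR ((c' - t) / 2).
    by rewrite -[leLHS]expR0 ler_expR divr_ge0 // subr_ge0 ltW.
  by move=> e1; case: (t < c) => /=; lra.
have eG : expR ((c' - t) / 2) * ((b - 2^-1) * G) <= expR ((c - t) / 2) * (b * G).
  have -> : (c - t) / 2 = (c' - t) / 2 + - (b^-1 / 2) by rewrite /c'; field; lra.
  rewrite expRD -mulrA ler_wpM2l ?expR_ge0 // mulrA ler_wpM2r //.
  have := ler_wpM2r (ltW b_gt0) (expR_ge1Dx (- (b^-1 / 2))).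
  by rewrite mulrDl mul1r mulNr mulrAC mulVf ?gt_eqF // mul1r.
have eF : expR (- (lambda * c') - a) * ((b + lambda) * F) <=
    expR (- (lambda * c) - a) * (b * F).
  have -> : - (lambda * c) - a = - (lambda * c') - a + lambda / b.
    by rewrite /c'; field; lra.
  rewrite [in leRHS]expRD -mulrA ler_wpM2l ?expR_ge0 // mulrA ler_wpM2r //.
  have := ler_wpM2r (ltW b_gt0) (expR_ge1Dx (lambda / b)).
  by rewrite mulrDl mul1r divfK ?gt_eqF.
apply: (@le_trans _ _ (\sum_(A in boundary g H) ((t < c)%R%:R +
    expR ((c' - t) / 2) * (1 + cover_potential R g s (add_edge H A).1) +
    expR (- (lambda * c') - a) * path_potential s theta w (add_edge H A)))).
  by apply: ler_sum => A _; rewrite lerD2r mulrDr mulr1 addrA lerD2r.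
rewrite big_split big_split /= -!mulr_sumr sumr_const -[_ *+ _]mulr_natl -/b.
rewrite [leRHS]mulrDr [X in _ <= X + _]mulrDr.
rewrite [b * (_ * G)]mulrCA [b * (_ * F)]mulrCA -addrA -[leRHS]addrA lerD2l.
apply: lerD; first by apply: le_trans eG; rewrite ler_wpM2l ?expR_ge0.
by apply: le_trans eF; rewrite ler_wpM2l ?expR_ge0.
Qed.

(** * Numerical bounds and the conclusion *)

Lemma connected_neighbor (T : finType) (g : rel T) (x : T) :
  connected_graph g -> (1 < #|T|)%N -> exists y, g x y.
Proof.
move=> gconn T1; have /card_gt0P[v] : (0 < #|~: [set x]|)%N.
  by rewrite -(ltn_add2l #|[set x]|) cardsC cards1 addn0.
rewrite !inE eq_sym => xv; by have [y gxy _] := dist_step gconn xv; exists y.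
Qed.

Lemma max_degree_gt0 (T : finType) (g : rel T) (x y : T) :
  g x y -> (0 < max_degree g)%N.
Proof.
move=> gxy; apply: leq_trans (degree_le_max g x).
by apply/card_gt0P; exists y; rewrite inE.
Qed.

Lemma degenerate_gt0 (T : finType) (g : rel T) (d : nat) (s : T) :
  simple_graph g -> degenerate d g -> (forall x, exists y, g x y) -> (0 < d)%N.
Proof.
move=> sg dg nbr; have [||x _ /=] := dg ([set: T], edges g).
- rewrite /is_subgraph subxx; apply/forall_inP => A _; exact: subsetT.
- by apply/set0Pn; exists s; rewrite inE.
have [y gxy] := nbr x; apply: leq_trans.
by apply/card_gt0P; exists y; rewrite inE /adj /= edges_set2.
Qed.

Lemma expR_half_le2 (R : realType) : expR (2^-1) <= 2 :> R.
Proof.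
have := expR_ge1Dx (- 2^-1 : R).
by rewrite expRN -[leRHS]mul1r ler_pdivlMr ?expR_gt0 //; lra.
Qed.

(** Since 2 e >= exp (3 / 2), the power is at least exp (h) exp (h / 2); the
    first factor beats exp (K c) and the second beats n ^ 2 = exp (2 L). *)
Lemma tall_tree_weight (R : realType) (K c t L : R) (h : nat) :
  1 <= K -> 0 <= t -> 4 * L <= t -> c <= t -> K * t < h%:R ->
  1 <= expR (- (K * c) - 2 * L) * (2 * expR 1) ^+ h.
Proof.
move=> K1 t0 Lt ct ht; have K0 : 0 <= K by lra.
have theta_ge : expR (3 / 2) <= 2 * expR 1 :> R.
  have -> : 3 / 2 = 2^-1 + 1 :> R by lra.
  by rewrite expRD ler_wpM2r ?expR_ge0 ?expR_half_le2.
have : expR (3 / 2) ^+ h <= (2 * expR 1) ^+ h :> R.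
  by rewrite lerXn2r ?nnegrE ?mulr_ge0 ?expR_ge0.
move/(ler_wpM2l (expR_ge0 (- (K * c) - 2 * L))); apply: le_trans.
rewrite -expRM_natl -expRD -[leLHS]expR0 ler_expR.
have : K * c <= K * t by rewrite ler_wpM2l.
have : t <= K * t by rewrite ler_peMl.
lra.
Qed.

Theorem theorem2 (R : realType) :
  exists2 A : R, 0 < A &
    forall (T : finType) (g : rel T) (d : nat) (s : T),
      simple_graph g -> connected_graph g -> degenerate d g ->
      1 - A / #|T|%:R <=
        spanning_tree_prob R g s (fun H : subgraph T =>
          (height s H)%:R <=
            8 * expR 1 * Num.sqrt (d%:R * (max_degree g)%:R) *
              (2 * (diameter g)%:R + 4 * ln #|T|%:R) :> R).
Proof.
exists 3 => // T g d s sg gconn dg; rewrite spanning_tree_probE.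
have T0 : (0 < #|T|)%N by apply/card_gt0P; exists s.
have n_gt0 : 0 < #|T|%:R :> R by rewrite ltr0n.
(* With one vertex, d and Delta may be 0, but the bound 1 - 3 / n is negative. *)
have [T1|T1] := leqP #|T| 1.
  apply: le_trans (growth_iter_ge0 g _ _ (fun H => ler0n R _)).
  rewrite subr_le0 ler_pdivlMr // mul1r -[3]/(3%:R) ler_nat; lia.
have nbr x := connected_neighbor x gconn T1.
have [y0 gsy0] := nbr s.
set sigma := Num.sqrt _; set D : R := (diameter g)%:R; set L := ln _.
set t := 2 * D + 4 * L.
have sigma2 : sigma ^+ 2 = (d * max_degree g)%:R :> R.
  by rewrite natrM sqr_sqrtr ?mulr_ge0.
have sigma1 : 1 <= sigma.
  rewrite -sqrtr1 ler_sqrt ?mulr_ge0 // -natrM ler1n muln_gt0.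
  by rewrite (degenerate_gt0 s sg dg nbr) (max_degree_gt0 gsy0).
have e2 : 2 <= expR 1 :> R by have := expR_ge1Dx (1 : R); lra.
have L0 : 0 <= L by rewrite ln_ge0 // ler1n.
have D0 : 0 <= D by [].
have t0 : 0 <= t by rewrite /t; lra.
have eL : expR L = #|T|%:R by rewrite lnK ?posrE.
pose rho : R := 4 * sigma; pose theta : R := 2 * expR 1.
have rho0 : 0 < rho by rewrite /rho; lra.
have [|w [w1 wrho wn]] := exists_vertex_weight sg dg rho0.
  by rewrite /rho exprMn sigma2; ring.
have w0 x : 0 <= w x by apply: le_trans (w1 x).
have theta0 : 0 <= theta by rewrite /theta; lra.
set K := 8 * expR 1 * sigma.
have KE : K = theta * rho by rewrite /K /theta /rho; ring.
have K1 : 1 <= K by rewrite /K; nra.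
pose psi H c := 1 - tail_bound g s w theta (theta * rho) (2 * L) t H c.
apply: le_trans (clocked_growth_bound (psi := psi) sg gconn _ _ 0); last 2 first.
- move=> H c rH b0; rewrite /psi sumrB sumr_const mulrBr mulr1 lerD2l lerN2.
  exact: tail_bound_step.
- move=> H c rH; have [_|hgt] := leP _ (K * t).
    rewrite lerBlDr lerDl /tail_bound !addr_ge0 ?mulr_ge0 ?expR_ge0 //.
      exact: cover_potential_ge0.
    exact: path_potential_ge0.
  rewrite subr_le0 /tail_bound.
  have G0 : 0 <= expR ((c - t) / 2) * cover_potential R g s H.1.
    by rewrite mulr_ge0 ?expR_ge0 ?cover_potential_ge0.
  have F0 := path_potential_ge0 s H theta0 w0.
  have [tc|ct] := ltP t c.
    rewrite /= -addrA lerDl.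
    by rewrite addr_ge0 ?mulr_ge0 ?expR_ge0 ?cover_potential_ge0.
  rewrite /= add0r; apply: ler_wpDl => //.
  have [|p rp sp] := @height_attained T s H.
    by rewrite -(ltr_nat R); apply: le_lt_trans hgt; rewrite mulr_ge0 //; lra.
  have := path_potential_ge theta0 w1 rp; rewrite sp => leF.
  apply: le_trans (ler_wpM2l (expR_ge0 _) leF).
  rewrite -KE; apply: tall_tree_weight ct hgt => //.
  by rewrite /t lerDr mulr_ge0.
rewrite /psi lerD2l lerN2 /tail_bound ltNge t0 add0r mulr0 oppr0 !sub0r.
rewrite path_potential_root.
have eLi : expR (- L) = #|T|%:R^-1 by rewrite expRN eL.
have e2L : expR (- (2 * L)) = #|T|%:R^-1 * #|T|%:R^-1.
  by rewrite -eLi -expRD; congr expR; lra.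
(* The path term starts at w s / n ^ 2, and the cover term at most at
   exp (- t / 2) n 2 ^ D <= 1 / n, because exp (- t / 2) = exp (- D) / n ^ 2. *)
have lew : expR (- (2 * L)) * w s <= 2 / #|T|%:R.
  apply: le_trans (ler_wpM2l (expR_ge0 _) (wn s)) _.
  by rewrite e2L le_eqVlt; apply/orP; left; apply/eqP; field; rewrite gt_eqF.
suff : expR (- t / 2) * cover_potential R g s [set s] <= 1 / #|T|%:R by lra.
apply: le_trans (ler_wpM2l (expR_ge0 _) (cover_potential_root R g s)) _.
have -> : - t / 2 = - (2 * L) - D by rewrite /t; lra.
rewrite expRD e2L expRN.
have le2D : 2 ^+ diameter g <= expR D.
  by rewrite -[D]mulr1 /D expRM_natl lerXn2r ?nnegrE ?expR_ge0.
have -> : #|T|%:R^-1 * #|T|%:R^-1 * (expR D)^-1 * (#|T|%:R * 2 ^+ diameter g) =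
    #|T|%:R^-1 * (2 ^+ diameter g / expR D) :> R.
  by field; rewrite !gt_eqF ?expR_gt0.
rewrite mul1r ler_piMr ?invr_ge0 //.
by rewrite ler_pdivrMr ?expR_gt0 // mul1r.
Qed.
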